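(* Let $\mathbf G\sim\mathcal G(\mathbf n,P)$, where $P=(p_{ij})_{i,j\in[k]}$ satisfies $p_{ij}=p_{ji}$ and $0\le p_{ij}<1$. Let $\sigma\in[0,\sigma_0]$ for some fixed $0<\sigma_0<\tfrac12$. Assume that $$\|\mathbf n\|\to\infty,\quad k=\|\mathbf n\|^{o(1)},\quad q^*=\|\mathbf n\|^{-\sigma+o(1)},\quad\hat q(\mathbf n)=\|\mathbf n\|^{-\sigma+o(1)},\quad\Big(1+\frac1{q^*}\Big)\max_{i,j}q_{ij}\ll\log\|\mathbf n\|,$$ and $$n_*=\|\mathbf n\|^{1+o(1)},\qquad n_*\gg\frac{w(\mathbf n,Q)}{\log\|\mathbf n\|},$$ where $n_*=\min_{i\in[k]}n_i$. Then, with high probability, $\alpha_h(\mathbf G)=(1-\sigma+o(1))\log\|\mathbf n\|$.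
   Context: Stochastic block model $\mathcal G(\mathbf n,P)$: vertex set partitioned into blocks $B_1,\dots,B_k$ with $|B_i|=n_i$; distinct $u\in B_i,v\in B_j$ adjacent independently with probability $p_{ij}$. $Q=(q_{ij})$ with $q_{ij}=\log\frac1{1-p_{ij}}$; $q^*=\max_iq_{ii}$; $\hat q(\mathbf x)=\sum_ix_iq_{ii}/\|\mathbf x\|$; $\|\cdot\|$ is the 1-norm; $w(\mathbf x,Q)=\max_{\mathbf 0\preceq\mathbf y\preceq\mathbf x}\frac{\mathbf y^TQ\mathbf y}{\|\mathbf y\|}$ where $\mathbf y\preceq\mathbf x$ means $\mathbf x-\mathbf y\in[0,\infty)^k$ (ratio $0$ at $\mathbf 0$). Weighted independence number: for $U\subseteq V(\mathbf G)$ nonempty, $h(U)=-\frac{\log\Pr(U\text{ is an independent set of }\mathbf G)}{|U|}$, and for a graph $G$ on $V(\mathbf G)$, $\alpha_h(G)=\max\{h(U):U\ne\emptyset\text{ independent in }G\}$; here $\alpha_h(\mathbf G)$ is this quantity evaluated at the random graph $\mathbf G$ (weights $h$ are deterministic). Quantities depend on $n\to\infty$; ''with high probability'' = with probability tending to $1$. *)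

(* Defs.v *)
From mathcomp Require Import all_boot all_order all_algebra.
From mathcomp Require Import all_classical all_reals all_analysis.

Set Implicit Arguments.
Unset Strict Implicit.
Unset Printing Implicit Defensive.

Import Order.TTheory GRing.Theory Num.Theory.
Import numFieldNormedType.Exports.

Local Open Scope classical_set_scope.
Local Open Scope ring_scope.

Section Graph.
Variable V : finType.

(* Unordered pairs of distinct vertices, each represented by its increasing
   representative for the enumeration order of V. *)
Definition edge : finType :=
  {uv : V * V | (enum_rank uv.1 < enum_rank uv.2)%N}.

Definition sgraph : finType := {set edge}.

Definition adj (G : sgraph) (u v : V) : bool :=
  [exists e in G, (val e == (u, v)) || (val e == (v, u))].

Definition indep_set (G : sgraph) (U : {set V}) : bool :=
  [forall u in U, forall v in U, ~~ adj G u v].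

End Graph.

Section Quantities.
Variable R : realType.

Definition norm1 k (x : 'cV[R]_k) : R := \sum_(i < k) `|x i 0|.

(* At y = 0 the value is 0, since 0^-1 = 0. *)
Definition quad_ratio k (Q : 'M[R]_k) (y : 'cV[R]_k) : R :=
  (y^T *m Q *m y) 0 0 / norm1 y.

(* The supremum is a maximum: quad_ratio Q is continuous on the compact box
   (at 0 too, because |quad_ratio Q y| <= (max |Q i j|) * norm1 y). *)
Definition wfun k (x : 'cV[R]_k) (Q : 'M[R]_k) : R :=
  sup [set quad_ratio Q y | y in
    [set y : 'cV[R]_k | forall i, 0 <= y i 0 <= x i 0]].

Definition qmx k (P : 'M[R]_k) : 'M[R]_k :=
  \matrix_(i, j) ln (1 / (1 - P i j)).

(* The default value 0 of the maxima below is harmless: all the entries of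
   qmx P are nonnegative when 0 <= P i j < 1. *)
Definition qstar k (Q : 'M[R]_k) : R := \big[Num.max/0]_(i < k) Q i i.

Definition qmax k (Q : 'M[R]_k) : R :=
  \big[Num.max/0]_(i < k) \big[Num.max/0]_(j < k) Q i j.

Definition qhat k (x : 'cV[R]_k) (Q : 'M[R]_k) : R :=
  (\sum_(i < k) x i 0 * Q i i) / norm1 x.

Definition sizes k (n : 'I_k -> nat) : 'cV[R]_k := \col_i (n i)%:R.

(* The default value of the minimum is an upper bound of all the n i, so it
   plays no role as soon as k > 0. *)
Definition nmin k (n : 'I_k -> nat) : nat :=
  \big[minn/(\sum_(i < k) n i)%N]_(i < k) n i.

End Quantities.

Section BlockModel.
Variables (R : realType) (k : nat) (n : 'I_k -> nat) (P : 'M[R]_k).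

(* A vertex is a block i (its tag) together with an element of 'I_(n i). *)
Definition vertex : finType := {i : 'I_k & 'I_(n i)}.

Definition edge_prob (e : edge vertex) : R :=
  P (tag (val e).1) (tag (val e).2).

Definition sbm_mass (G : sgraph vertex) : R :=
  \prod_(e : edge vertex) (if e \in G then edge_prob e else 1 - edge_prob e).

Definition sbm_Pr (A : pred (sgraph vertex)) : R :=
  \sum_(G : sgraph vertex | A G) sbm_mass G.

Definition hweight (U : {set vertex}) : R :=
  - ln (sbm_Pr (fun G => indep_set G U)) / #|U|%:R.

(* The default value 0 is harmless, as hweight is nonnegative and singletons
   are independent. *)
Definition alpha_h (G : sgraph vertex) : R :=
  \big[Num.max/0]_(U : {set vertex} | (U != finset.set0) && indep_set G U)
    hweight U.

End BlockModel.

Section Asymptotics.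
Variable R : realType.

(* a = N^(c + o(1)) *)
Definition eq_pow_o1 (a N c : nat -> R) : Prop :=
  exists2 eps : nat -> R, eps @ \oo --> 0
    & \forall m \near \oo, a m = N m `^ (c m + eps m).

End Asymptotics.

(* Main.v *)
Require Import Defs.
From mathcomp Require Import all_boot all_order all_algebra.
From mathcomp Require Import all_classical all_reals all_analysis.
From mathcomp Require Import ring lra zify.

(**
Write [L = log N]. Upper bound, by first moments: an independent set [U] with
[h U > (1 - sigma + eps) L] must have [#|U| >= N^(sigma - eps/2)], because
[h U <= #|U| max q] and [max q << q* L]. The expected number of such sets is
at most [\sum_s 'C(N, s) exp(- (1 - sigma + eps) L s)], and for these [s] each
summand is at most [(e N^(- eps/2))^s].

Lower bound, by second moments: it suffices to look inside one block [B_i] with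
[q_ii = q*], where the graph is an Erdos-Renyi graph on [N^(1 - o(1))]
vertices. A set of [s ~ 2 (1 - sigma - delta) L / q*] vertices of that block has
weight [(s - 1) q* / 2], and the second moment of the number of independent
[s]-sets is controlled by [\sum_l 'C(s, l) (s/n)^l exp(q* 'C(l, 2))], which is
[1 + o(1)] because [sigma <= sigma0 < 1/2].
*)

Set Implicit Arguments.
Unset Strict Implicit.

Import Order.TTheory GRing.Theory Num.Theory.
Import numFieldNormedType.Exports.

Local Open Scope ring_scope.

(** * Edges inside a vertex set *)

Section InnerEdges.
Variable V : finType.
Implicit Types (G : sgraph V) (U W : {set V}) (e : edge V).

Definition inner_edges U : {set edge V} :=
  [set e : edge V | ((val e).1 \in U) && ((val e).2 \in U)]%SET.

(** Turns independence into the absence of a fixed set of edges, an event whose probability is a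
    product over that set. *)
Lemma indep_setE G U : indep_set G U = [disjoint G & inner_edges U].
Proof.
apply/idP/idP => [/forall_inP indG | /disjoint_setI0 /setP GU0].
  rewrite disjoint_subset; apply/fintype.subsetP => e eG.
  rewrite inE /= inE; apply/negP => /andP[e1U e2U].
  have /forall_inP/(_ _ e2U)/negP := indG _ e1U; apply.
  by apply/exists_inP; exists e; rewrite // -surjective_pairing eqxx.
apply/forall_inP => u uU; apply/forall_inP => v vU.
apply/exists_inP => -[e eG /orP[] /eqP euv];
  have := GU0 e; rewrite !inE eG euv /= ?uU ?vU; done.
Qed.

Lemma inner_edgesI U W :
  inner_edges (U :&: W) = (inner_edges U :&: inner_edges W)%SET.
Proof. by apply/setP => e; rewrite !inE andbACA. Qed.

Lemma inner_edgesS U W : U \subset W -> inner_edges U \subset inner_edges W.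
Proof.
move=> /fintype.subsetP sUW; apply/fintype.subsetP => e.
by rewrite !inE => /andP[/sUW -> /sUW ->].
Qed.

(** Sending an edge to its set of endpoints is injective, since only the increasing representative
    of a pair is an edge; the image of the inner edges is the family of 2-subsets of [U]. *)
Lemma card_inner_edges U : #|inner_edges U| = 'C(#|U|, 2).
Proof.
pose f e := [set (val e).1; (val e).2]%SET.
have f_inj : injective f.
  move=> [[a b] /= ab] [[c d] /= cd] /= /setP eq_f; apply: val_inj => /=.
  have := eq_f a; have := eq_f b.
  rewrite /= !inE !eqxx ?orbT /= => /esym b_cd /esym a_cd.
  move: (ab); case/orP: b_cd => /eqP ->; case/orP: a_cd => /eqP ->;
    by rewrite ?ltnn // ltnNge ltnW.
rewrite -cards_draws -(card_imset _ f_inj); apply: eq_card => A.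
rewrite inE; apply/imsetP/andP => [[e] | [sAU /cards2P[x [y [xy defA]]]]].
  rewrite inE => /andP[e1 e2] ->; split.
    by apply/fintype.subsetP => x; rewrite !inE => /orP[] /eqP ->.
  rewrite cards2; case: (_ =P (val e).2) => // e12.
  by have := valP e; rewrite /= e12 ltnn.
have [xU yU] : x \in U /\ y \in U.
  by split; apply: (fintype.subsetP sAU); rewrite defA !inE eqxx ?orbT.
have : enum_rank x != enum_rank y by apply: contra_neq xy => /enum_rank_inj.
rewrite -val_eqE neq_ltn => /orP[] lt_r.
  by exists (Sub (x, y) lt_r : edge V); rewrite ?inE ?SubK ?xU //= defA.
exists (Sub (y, x) lt_r : edge V); rewrite ?inE ?SubK ?yU //=.
by rewrite defA finset.setUC.
Qed.

End InnerEdges.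

(** * The product measure on graphs and the independence events *)

Section Model.
Variables (R : realType) (k : nat) (n : 'I_k -> nat) (P : 'M[R]_k).
Hypothesis P01 : forall i j, 0 <= P i j < 1.

Implicit Types (G : sgraph (vertex n)) (A B : pred (sgraph (vertex n))).
Implicit Types (U W : {set vertex n}).

Lemma edge_prob01 (e : edge (vertex n)) : 0 <= edge_prob P e < 1.
Proof. exact: P01. Qed.

Lemma sbm_mass_ge0 G : 0 <= sbm_mass P G.
Proof.
apply: prodr_ge0 => e _; have /andP[p0 p1] := edge_prob01 e.
by case: ifP => // _; rewrite subr_ge0 ltW.
Qed.

(* Expanding [\prod_e (x e + (1 - p e))], where [x e] is [0] on [F] and [p e]
   elsewhere, gives exactly the mass of the graphs avoiding [F]. *)
Lemma sbm_Pr_disjoint (F : {set edge (vertex n)}) :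
  sbm_Pr P (fun G => [disjoint G & F]) = \prod_(e in F) (1 - edge_prob P e).
Proof.
pose x e := if e \in F then 0 else edge_prob P e.
transitivity (\prod_(e : edge (vertex n)) (x e + (1 - edge_prob P e))).
  rewrite bigA_distr /sbm_Pr big_mkcond /=; apply: eq_bigr => G _.
  case: ifP => [dGF | /negbT/pred0Pn[e /andP[eG eF]]].
    apply: eq_bigr => e _; rewrite /x.
    by case: ifP => // eG; rewrite (disjointFr dGF eG).
  by rewrite (bigD1 e) //= [e \in G]eG /x [e \in F]eF mul0r.
rewrite [RHS]big_mkcond; apply: eq_bigr => e _; rewrite /x.
by case: ifP; rewrite ?add0r // addrC subrK.
Qed.

(** The case [F] empty of [sbm_Pr_disjoint]. *)
Lemma sbm_Pr_predT : sbm_Pr (n := n) P predT = 1.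
Proof.
rewrite -[RHS](big_set0 _ *%R (fun e => 1 - edge_prob (n := n) P e)).
rewrite -sbm_Pr_disjoint; apply: eq_bigl => G.
by rewrite disjoint_sym; apply/esym/pred0P => e; rewrite /= inE.
Qed.

Lemma sbm_Pr_ge0 A : 0 <= sbm_Pr P A.
Proof. by apply: sumr_ge0 => G _; exact: sbm_mass_ge0. Qed.

Lemma sbm_PrC A : sbm_Pr P (predC A) = 1 - sbm_Pr P A.
Proof.
rewrite -sbm_Pr_predT /sbm_Pr [X in _ = X - _](bigID A) /=.
by rewrite addrAC subrr add0r.
Qed.

Lemma sbm_Pr_le1 A : sbm_Pr P A <= 1.
Proof. by rewrite -subr_ge0 -sbm_PrC sbm_Pr_ge0. Qed.

Lemma sbm_Pr_sub A B : (forall G, A G -> B G) -> sbm_Pr P A <= sbm_Pr P B.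
Proof.
move=> AB; rewrite /sbm_Pr [leRHS]big_mkcond [leLHS]big_mkcond /=.
apply: ler_sum => G _; have := AB G; case: (A G) => [-> // | _].
by case: ifP => // _; exact: sbm_mass_ge0.
Qed.

Lemma sbm_PrU A B :
  sbm_Pr P (fun G => A G || B G) <= sbm_Pr P A + sbm_Pr P B.
Proof.
rewrite /sbm_Pr !(big_mkcond _ (sbm_mass P)) -big_split /=.
apply: ler_sum => G _; have := sbm_mass_ge0 G.
by case: (A G); case: (B G) => /=; lra.
Qed.

Lemma sbm_Pr_union (T : finType) (D : pred T)
    (A_ : T -> pred (sgraph (vertex n))) :
  sbm_Pr P (fun G => [exists t, D t && A_ t G]) <=
  \sum_(t | D t) sbm_Pr P (A_ t).
Proof.
rewrite /sbm_Pr [leLHS]big_mkcond /=.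
under [leRHS]eq_bigr do rewrite big_mkcond.
rewrite exchange_big /=; apply: ler_sum => G _.
case: ifP => [/existsP[t /andP[Dt At]] | _].
  rewrite (bigD1 t) //= At lerDl; apply: sumr_ge0 => t' _.
  by case: ifP => // _; exact: sbm_mass_ge0.
by apply: sumr_ge0 => t' _; case: ifP => // _; exact: sbm_mass_ge0.
Qed.

Lemma sbm_Pr_indep U :
  sbm_Pr P (fun G => indep_set G U) =
  \prod_(e in inner_edges U) (1 - edge_prob P e).
Proof.
by rewrite -sbm_Pr_disjoint; apply: eq_bigl => G; rewrite indep_setE.
Qed.

Lemma sbm_Pr_indepI U W :
  sbm_Pr P (fun G => indep_set G U && indep_set G W) =
  \prod_(e in inner_edges U :|: inner_edges W) (1 - edge_prob P e).
Proof.
rewrite -sbm_Pr_disjoint; apply: eq_bigl => G; rewrite !indep_setE.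
by rewrite -!setI_eq0 finset.setIUr finset.setU_eq0.
Qed.

Lemma sbm_Pr_indep_gt0 U : 0 < sbm_Pr P (fun G => indep_set G U).
Proof.
rewrite sbm_Pr_indep; apply: prodr_gt0 => e _.
by have /andP[_] := edge_prob01 e; rewrite subr_gt0.
Qed.

Lemma sbm_Pr_indepE U : U != finset.set0 ->
  sbm_Pr P (fun G => indep_set G U) = expR (- (hweight P U * #|U|%:R)).
Proof.
rewrite -card_gt0 => U0; rewrite /hweight divfK ?pnatr_eq0 -?lt0n //.
by rewrite opprK lnK // posrE sbm_Pr_indep_gt0.
Qed.

Lemma qmx_le_qmax i j : qmx P i j <= qmax (qmx P).
Proof.
apply: le_trans (le_bigmax _ (fun i => \big[Num.max/0]_(j < k) qmx P i j) i).
exact: le_bigmax.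
Qed.

Lemma qmx_ge0 i j : 0 <= qmx P i j.
Proof.
have /andP[p0 p1] := P01 i j.
by rewrite mxE ln_ge0 // div1r invf_ge1 ?subr_gt0 // gerBl.
Qed.

Lemma qmax_ge0 : 0 <= qmax (qmx P).
Proof. exact: bigmax_ge_id. Qed.

Lemma expR_qmx i j : expR (- qmx P i j) = 1 - P i j.
Proof.
have /andP[_ p1] := P01 i j; have p1' : 0 < 1 - P i j by rewrite subr_gt0.
by rewrite mxE div1r lnV ?posrE // opprK lnK // posrE.
Qed.

(** At most [#|U| ^ 2] inner edges each contribute at most [qmax] to the negated logarithm. This
    forces heavy sets to be large. *)
Lemma hweight_le_qmax U : hweight P U <= #|U|%:R * qmax (qmx P).
Proof.
have [->|U0] := eqVneq U finset.set0.
  by rewrite /hweight finset.cards0 invr0 mulr0 mul0r.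
have U0' : 0 < (#|U|%:R : R) by rewrite ltr0n card_gt0.
rewrite /hweight ler_pdivrMr // mulrAC -natrM lerNl -ler_expR.
rewrite lnK ?posrE ?sbm_Pr_indep_gt0 // sbm_Pr_indep.
apply: (@le_trans _ _ (expR (- qmax (qmx P)) ^+ #|inner_edges U|)).
  rewrite -expRM_natl ler_expR mulrN lerN2 ler_wpM2r ?qmax_ge0 // ler_nat.
  by rewrite card_inner_edges bin2; nia.
rewrite -prodr_const; apply: ler_prod => e _; rewrite expR_ge0 /=.
by rewrite -[1 - _]expR_qmx ler_expR lerN2 qmx_le_qmax.
Qed.

End Model.

(** * Binomial estimates and counting of overlapping subsets *)

Section Counting.
Variable R : realType.

Lemma sum_subset_card (T : finType) (B : {set T}) (f : nat -> R) :
  \sum_(A : {set T} | A \subset B) f #|A| =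
  \sum_(l < #|B|.+1) 'C(#|B|, l)%:R * f l.
Proof.
(* [inord] is faithful on the range of summation, where [#|A| <= #|B|]. *)
pose c (A : {set T}) : 'I_#|B|.+1 := inord #|A|.
rewrite (partition_big c predT) //=; apply: eq_bigr => l _.
rewrite -cards_draws -[X in X%:R]sum1_card natr_sum mulr_suml.
apply: eq_big => [A | A /andP[sAB /eqP <-]].
  rewrite inE; case sAB: (A \subset B) => //=.
  by rewrite -val_eqE /= inordK // ltnS subset_leq_card.
by rewrite mul1r /c inordK // ltnS subset_leq_card.
Qed.

Lemma ffact_le_exp m l : (m ^_ l <= m ^ l)%N.
Proof.
elim: l => [|l IHl]; first by rewrite ffactn0.
by rewrite ffactnSr expnSr; apply: leq_mul; rewrite ?leq_subr.
Qed.

Lemma bin_le_exp m l : 'C(m, l)%:R <= m%:R ^+ l :> R.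
Proof.
rewrite -natrX ler_nat; apply: leq_trans (ffact_le_exp m l).
by rewrite -bin_ffact leq_pmulr // fact_gt0.
Qed.

(** [l ^ l / l!] is a single term of the series of [expR l]. *)
Lemma expr_le_fact_expR l : l%:R ^+ l <= l`!%:R * expR (l%:R : R).
Proof.
case: l => [|l]; first by rewrite expr0 fact0 mul1r expR0.
rewrite mulrC -ler_pdivrMr ?ltr0n ?fact_gt0 //.
by apply: le_trans (expR_ge1Dxn l _); rewrite ?ler0n // lerDr.
Qed.

Lemma bin_le_expR m l : (0 < l)%N ->
  'C(m, l)%:R <= (expR 1 * m%:R / l%:R) ^+ l :> R.
Proof.
move=> l0; rewrite exprMn exprVn ler_pdivlMr ?exprn_gt0 ?ltr0n //.
rewrite exprMn -expRM_natl mulr1.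
apply: le_trans (ler_wpM2l _ (expr_le_fact_expR l)) _ => //.
rewrite mulrA -natrM bin_ffact mulrC ler_wpM2l ?expR_ge0 //.
by rewrite -natrX ler_nat ffact_le_exp.
Qed.

Lemma sum_geometric_le (r : R) m : 0 <= r <= 1 / 2 ->
  \sum_(l < m) r ^+ l.+1 <= 2 * r.
Proof.
move=> /andP[r0 r1]; elim: m => [|m IHm]; first by rewrite big_ord0; lra.
rewrite big_ord_recl expr1.
under eq_bigr do rewrite exprS.
by rewrite -mulr_sumr; nra.
Qed.

(** Cleared of denominators: a uniform [s]-subset of [n] points contains [l] given points with
    probability at most [(s / n) ^ l]. Each induction step costs the factor
    [(s - l) / (n - l) <= s / n]. *)
Lemma bin_sub_mul_le n s l : (l <= s <= n)%N ->
  ('C(n - l, s - l) * n ^ l <= 'C(n, s) * s ^ l)%N.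
Proof.
move=> /andP[+ sn]; elim: l => [|l IHl] ls; first by rewrite !subn0.
have {}IHl := IHl (ltnW ls).
have [a an] : exists a, (n - l)%N = a.+1 by exists (n - l.+1)%N; lia.
have [b bs] : exists b, (s - l)%N = b.+1 by exists (s - l.+1)%N; lia.
have -> : (n - l.+1)%N = a by lia.
have -> : (s - l.+1)%N = b by lia.
rewrite an bs in IHl; have /= diag := mul_bin_diag a.+1 b.
have ba : (b.+1 * n <= a.+1 * s)%N by nia.
rewrite -(leq_pmul2l (ltn0Sn a)) mulnA diag !expnS.
apply: leq_trans (_ : a.+1 * s * ('C(a.+1, b.+1) * n ^ l) <= _)%N.
  by rewrite mulnACA leq_mul2r ba orbT.
rewrite [('C(n, s) * _)%N]mulnCA [leqRHS]mulnA.
by rewrite leq_mul2l IHl orbT.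
Qed.

Variables (T : finType) (B : {set T}) (s : nat).
Let n := #|B|.
Let D := [set A : {set T} | A \subset B & #|A| == s]%SET.

(** Removing [A] injects these supersets into the subsets of [B :\: A] of size [s - #|A|]. *)
Lemma card_supersets_le (A : {set T}) : A \subset B ->
  (#|[set W in D | A \subset W]%SET| <= 'C(n - #|A|, s - #|A|))%N.
Proof.
move=> sAB; pose g (W : {set T}) := (W :\: A)%SET.
have inj_g : {in [set W in D | A \subset W]%SET &, injective g}.
  move=> W W'; rewrite !inE => /andP[_ sAW] /andP[_ sAW'] eqg.
  rewrite -[LHS](finset.setID _ A) -[RHS](finset.setID _ A).
  by rewrite (finset.setIidPr sAW) (finset.setIidPr sAW'); congr (_ :|: _)%SET.
rewrite -(card_in_imset inj_g).
have -> : (n - #|A|)%N = #|(B :\: A)%SET|.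
  by rewrite cardsD (finset.setIidPr sAB).
rewrite -cards_draws; apply/subset_leq_card/fintype.subsetP => X /imsetP[W].
rewrite !inE => /andP[/andP[sWB /eqP <-] sAW] ->.
by rewrite finset.setSD //= cardsD (finset.setIidPr sAW).
Qed.

(* Bounding [z ^+ 'C(#|U :&: W|, 2)] by the sum of [z ^+ 'C(#|A|, 2)] over all
   common subsets [A] of [U] and [W] avoids counting exact intersections. *)
Lemma sum_overlap_le (U : {set T}) (z : R) : 0 <= z -> (0 < s <= n)%N ->
    U \in D ->
  \sum_(W in D) z ^+ 'C(#|U :&: W|, 2) <=
  'C(n, s)%:R *
  \sum_(l < s.+1) 'C(s, l)%:R * ((s%:R / n%:R) ^+ l * z ^+ 'C(l, 2)).
Proof.
move=> z0 /andP[s0 sn]; rewrite inE => /andP[sUB /eqP cardU].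
have n0 : (0 < n)%N := leq_trans s0 sn.
apply: (@le_trans _ _ (\sum_(W in D) \sum_(A : {set T} | A \subset U)
    (A \subset W)%:R * z ^+ 'C(#|A|, 2))).
  apply: ler_sum => W _; rewrite (bigD1 (U :&: W)%SET) ?finset.subsetIl //=.
  rewrite finset.subsetIr mul1r lerDl; apply: sumr_ge0 => A _.
  by rewrite mulr_ge0 ?exprn_ge0.
pose f l : R := (s%:R / n%:R) ^+ l * z ^+ 'C(l, 2).
have := sum_subset_card U f; rewrite cardU => <-.
(* With the sums exchanged, a fixed [A] is weighted by the number of [W] in [D] that contain it. *)
rewrite exchange_big /= mulr_sumr; apply: ler_sum => A sAU.
have sAB := fintype.subset_trans sAU sUB.
have lAs : (#|A| <= s)%N by rewrite -cardU subset_leq_card.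
rewrite /f -mulr_suml mulrA; apply: ler_wpM2r; first exact: exprn_ge0.
rewrite exprMn exprVn mulrA ler_pdivlMr ?exprn_gt0 ?ltr0n //.
rewrite -natr_sum -!natrX -!natrM ler_nat.
apply: leq_trans (bin_sub_mul_le (l := #|A|) _); last by rewrite lAs.
rewrite leq_mul2r -big_mkcondr /= sum1dep_card.
by rewrite (leq_trans _ (card_supersets_le sAB)) ?orbT // cardsE.
Qed.

End Counting.

(** * The overlap sum of the second moment *)

Section Overlap.
Variable R : realType.

(* For small [l] the term is controlled by [s ^+ 2 / n], for large [l] by its
   value at [l = s]. *)
Lemma overlap_term_le (theta q r : R) (n s l : nat) :
    0 < theta -> 0 <= q -> (0 < l <= s)%N -> (0 < n)%N ->
    s%:R * s%:R / n%:R * expR (theta * (q * s%:R / 2)) <= r ->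
    expR 1 / theta * (s%:R / n%:R) * expR (q * s%:R / 2) <= r ->
  'C(s, l)%:R * ((s%:R / n%:R) ^+ l * expR q ^+ 'C(l, 2)) <= r ^+ l.
Proof.
move=> th0 q0 /andP[l0 ls] n0 Hsmall Hbig.
have n0' : 0 < (n%:R : R) by rewrite ltr0n.
have l0' : 0 < (l%:R : R) by rewrite ltr0n.
have s0' : 0 < (s%:R : R) by rewrite ltr0n (leq_trans l0).
have hz : expR q ^+ 'C(l, 2) <= expR (q * l%:R / 2) ^+ l.
  rewrite -!expRM_natl ler_expR.
  have h : ('C(l, 2)%:R : R) <= l%:R * (l%:R / 2).
    rewrite mulrA ler_pdivlMr // -!natrM ler_nat bin2; nia.
  by apply: le_trans (ler_wpM2r q0 h) _; lra.
have e0 : 0 <= expR (q * l%:R / 2) := expR_ge0 _.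
(* Up to [theta * s] the crude bound ['C(s, l) <= s ^ l] suffices; beyond it [(e * s / l) ^ l] is at
   most [(e / theta) ^ l]. *)
have [lth|lth] := leP l%:R (theta * s%:R).
  apply: (@le_trans _ _ ((s%:R * (s%:R / n%:R * expR (q * l%:R / 2))) ^+ l)).
    rewrite !exprMn; apply: ler_pM;
      rewrite ?mulr_ge0 ?exprn_ge0 ?invr_ge0 ?expR_ge0 ?ler0n ?bin_le_exp //.
    by apply: ler_wpM2l; rewrite // mulr_ge0 ?exprn_ge0 ?invr_ge0.
  apply: lerXn2r; rewrite ?nnegrE.
  - by rewrite !mulr_ge0 ?invr_ge0 ?ler0n.
  - by apply: le_trans Hsmall; rewrite !mulr_ge0 ?invr_ge0 ?expR_ge0 ?ler0n.
  apply: le_trans Hsmall; rewrite mulrA [s%:R * (_ / _)]mulrA.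
  apply: ler_wpM2l; first by rewrite !mulr_ge0 ?invr_ge0 ?ler0n.
  rewrite ler_expR; nra.
apply: (@le_trans _ _
  ((expR 1 * s%:R / l%:R * (s%:R / n%:R * expR (q * l%:R / 2))) ^+ l)).
  rewrite [leRHS]exprMn; apply: ler_pM;
    rewrite ?mulr_ge0 ?exprn_ge0 ?mulr_ge0 ?invr_ge0 ?expR_ge0 ?ler0n //;
    rewrite ?bin_le_expR //.
  by rewrite [leRHS]exprMn; apply: ler_wpM2l;
    rewrite // exprn_ge0 ?mulr_ge0 ?invr_ge0.
apply: lerXn2r; rewrite ?nnegrE.
- by rewrite !mulr_ge0 ?invr_ge0 ?expR_ge0 ?ler0n.
- by apply: le_trans Hbig; rewrite !mulr_ge0 ?invr_ge0 ?expR_ge0 ?ler0n // ltW.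
apply: le_trans Hbig; rewrite mulrA; apply: ler_pM.
- by rewrite !mulr_ge0 ?invr_ge0 ?expR_ge0 ?ler0n.
- exact: expR_ge0.
- apply: ler_wpM2r; first by rewrite !mulr_ge0 ?invr_ge0 ?ler0n.
  rewrite -mulrA; apply: ler_wpM2l; first exact: expR_ge0.
  by rewrite ler_pdivrMr // mulrC ler_pdivlMr // mulrC ltW.
- by rewrite ler_expR ler_pM2r ?invr_gt0 // ler_wpM2l // ler_nat.
Qed.

Lemma overlap_sum_le (theta q r : R) (n s : nat) :
    0 < theta -> 0 <= q -> (0 < s)%N -> (0 < n)%N -> r <= 1 / 2 ->
    s%:R * s%:R / n%:R * expR (theta * (q * s%:R / 2)) <= r ->
    expR 1 / theta * (s%:R / n%:R) * expR (q * s%:R / 2) <= r ->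
  \sum_(l < s.+1) 'C(s, l)%:R * ((s%:R / n%:R) ^+ l * expR q ^+ 'C(l, 2))
    <= 1 + 2 * r.
Proof.
move=> th0 q0 s0 n0 r1 Hsmall Hbig.
have r0 : 0 <= r.
  by apply: le_trans Hsmall; rewrite !mulr_ge0 ?invr_ge0 ?expR_ge0 ?ler0n.
rewrite big_ord_recl /= bin0 !expr0 !mulr1 lerD2l.
apply: le_trans (sum_geometric_le s _); last by rewrite r0.
by apply: ler_sum => l _; apply: (overlap_term_le (theta := theta)) => //=.
Qed.

End Overlap.

(** * First and second moment inequalities *)

Section Moments.
Variables (R : realType) (k : nat) (n : 'I_k -> nat) (P : 'M[R]_k).
Hypothesis P01 : forall i j, 0 <= P i j < 1.

Implicit Types (G : sgraph (vertex n)) (U W : {set vertex n}).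

Lemma card_vertex : #|vertex n| = (\sum_(i < k) n i)%N.
Proof.
rewrite card_tagged sumnE big_map big_enum /=.
by apply: eq_bigr => i _; rewrite card_ord.
Qed.

(** A union bound over the sets of weight above [c]: each is independent with probability at most
    [expR (- c) ^+ #|U|], and as their sizes are at least [s0], the sum over sizes is dominated by a
    geometric series in [r]. *)
Lemma alpha_h_gt_le (c s0 r : R) : 0 <= c -> 0 < s0 ->
    (forall U, c < hweight P U -> s0 <= #|U|%:R) ->
    expR 1 * #|vertex n|%:R / s0 * expR (- c) <= r -> r <= 1 / 2 ->
  sbm_Pr (n := n) P (fun G => c < alpha_h P G) <= 2 * r.
Proof.
move=> c0 s0_gt0 large Hr r1.
have r0 : 0 <= r.
  by apply: le_trans Hr; rewrite !mulr_ge0 ?invr_ge0 ?expR_ge0 ?ler0n // ltW.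
pose D U := (U != finset.set0) && (c < hweight P U).
(* Relaxing heaviness to a condition on the size makes the summand a function of [#|U|] alone. *)
pose f (l : nat) : R := ((0 < l)%N && (s0 <= l%:R))%:R * expR (- c) ^+ l.
have f_ge0 l : 0 <= f l by rewrite mulr_ge0 ?exprn_ge0 ?expR_ge0.
apply: (@le_trans _ _ (\sum_(U | D U) sbm_Pr P (fun G => indep_set G U))).
  apply: le_trans (sbm_Pr_union P01 _ _); apply: sbm_Pr_sub => // G.
  (* Without a heavy independent set the maximum is at most [c]; its default value [0] is covered by
     [0 <= c]. *)
  rewrite ltNge => /bigmax_leP alpha_gt; apply/existsP; apply: contrapT => noU.
  apply: alpha_gt; split=> // U /andP[U0 iU]; rewrite leNgt; apply/negP => cU.
  by apply: noU; exists U; rewrite /D U0 cU.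
apply: (@le_trans _ _
  (\sum_(U : {set vertex n} | U \subset finset.setT) f #|U|)).
  rewrite [leLHS]big_mkcond [leRHS]big_mkcond; apply: ler_sum => U _.
  rewrite finset.subsetT; case: ifP => // /andP[U0 cU].
  rewrite sbm_Pr_indepE // /f card_gt0 U0 large // mul1r -expRM_natl ler_expR.
  by rewrite mulrN lerN2 mulrC ler_wpM2r // ltW.
rewrite sum_subset_card cardsT big_ord_recl /= {1}/f /= mul0r mulr0 add0r.
apply: le_trans (sum_geometric_le _ _); last by rewrite r0.
apply: ler_sum => l _; rewrite /f /bump leq0n add1n /=.
have [sl|_] := leP s0 l.+1%:R; last by rewrite mul0r mulr0 exprn_ge0.
have /= binl := bin_le_expR R #|vertex n| (ltn0Sn l).
rewrite mul1r; apply: le_trans (ler_wpM2r (exprn_ge0 _ (expR_ge0 _)) binl) _.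
rewrite -exprMn; apply: lerXn2r; rewrite ?nnegrE //.
apply: le_trans Hr; rewrite ler_wpM2r ?expR_ge0 //.
by rewrite ler_wpM2l ?mulr_ge0 ?expR_ge0 ?ler0n // lef_pV2 ?posrE ?ltr0n.
Qed.

Definition block (i : 'I_k) : {set vertex n} := [set v | tag v == i]%SET.

Lemma card_block i : #|block i| = n i.
Proof.
pose f (j : 'I_(n i)) : vertex n := Tagged (fun i => 'I_(n i)) j.
have f_inj : injective f.
  by move=> a b /eqP; rewrite eq_Tagged /= => /eqP.
rewrite -[RHS]card_ord -(card_imset _ f_inj); apply: eq_card => -[i' v].
rewrite inE /=; apply/eqP/imsetP => [i'i | [j _ [] //]].
by move: v; rewrite i'i => v; exists v.
Qed.

Lemma prod_inner_block i (F : {set edge (vertex n)}) :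
    F \subset inner_edges (block i) ->
  \prod_(e in F) (1 - edge_prob P e) = expR (- qmx P i i) ^+ #|F|.
Proof.
move=> sF; rewrite -prodr_const; apply: eq_bigr => e /(fintype.subsetP sF).
by rewrite !inE expR_qmx // => /andP[/eqP e1 /eqP e2]; rewrite /edge_prob e1 e2.
Qed.

Lemma sbm_Pr_indep_block i U : U \subset block i ->
  sbm_Pr P (fun G => indep_set G U) = expR (- qmx P i i) ^+ 'C(#|U|, 2).
Proof.
move=> sU; rewrite sbm_Pr_indep //.
by rewrite (prod_inner_block (inner_edgesS sU)) card_inner_edges.
Qed.

(** The first two factors count the edges inside [U :&: W] twice; the third one cancels the
    repetition. *)
Lemma sbm_Pr_indepI_block i U W : U \subset block i -> W \subset block i ->
  sbm_Pr P (fun G => indep_set G U && indep_set G W) =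
  expR (- qmx P i i) ^+ 'C(#|U|, 2) * expR (- qmx P i i) ^+ 'C(#|W|, 2) *
  expR (qmx P i i) ^+ 'C(#|U :&: W|, 2).
Proof.
move=> sU sW; rewrite sbm_Pr_indepI //.
rewrite (@prod_inner_block i); last by rewrite finset.subUset !inner_edgesS.
rewrite -!card_inner_edges inner_edgesI -exprD -finset.cardsUI exprD -mulrA.
by rewrite -exprMn -expRD addNr expR0 expr1n mulr1.
Qed.

Lemma hweight_block i U : U \subset block i -> U != finset.set0 ->
  hweight P U = (#|U|%:R - 1) / 2 * qmx P i i.
Proof.
move=> sU U0; rewrite /hweight (sbm_Pr_indep_block sU) -expRM_natl expRK.
have c0 : (0 < #|U|)%N by rewrite card_gt0.
have c0' : (#|U|%:R : R) != 0 by rewrite pnatr_eq0 -lt0n.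
(* [bin2] involves a truncated half, exact here because [#|U| * (#|U| - 1)] is even. *)
have -> : 'C(#|U|, 2)%:R = #|U|%:R * (#|U|%:R - 1) / 2 :> R.
  apply: (@mulIf _ 2); rewrite ?pnatr_eq0 // divfK ?pnatr_eq0 //.
  rewrite -natrM bin2 muln2 even_halfK; last first.
    by case: #|U| => // m; rewrite oddM /= andNb.
  by rewrite natrM -subn1 natrB.
by field.
Qed.

(* [2 x - x ^+ 2 <= 1] applied to the number of independent [s]-subsets of the
   block divided by its mean. *)
Lemma block_second_moment i s : (0 < s <= n i)%N ->
  2 - \sum_(l < s.+1)
        'C(s, l)%:R * ((s%:R / (n i)%:R) ^+ l * expR (qmx P i i) ^+ 'C(l, 2))
  <= sbm_Pr (n := n) P (fun G =>
       [exists U : {set vertex n},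
         [&& U \subset block i, #|U| == s & indep_set G U]]).
Proof.
move=> s_n.
pose D := [set U : {set vertex n} | U \subset block i & #|U| == s]%SET.
set S := \sum_(l < _) _; pose b := expR (- qmx P i i) ^+ 'C(s, 2).
pose X G : R := \sum_(U in D) (indep_set G U)%:R.
pose M : R := 'C(n i, s)%:R; pose mu := M * b.
have M0 : 0 < M by rewrite ltr0n bin_gt0; case/andP: s_n.
have b0 : 0 < b by rewrite exprn_gt0 ?expR_gt0.
have mu0 : 0 < mu by rewrite mulr_gt0.
have cardD : #|D| = 'C(n i, s) by rewrite cards_draws card_block.
have EX : \sum_G sbm_mass P G * X G = mu.
  under eq_bigr do rewrite mulr_sumr.
  rewrite exchange_big /= /mu /M -cardD -sum1_card natr_sum mulr_suml.
  apply: eq_bigr => U; rewrite inE mul1r => /andP[sU /eqP cU].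
  rewrite /b -cU -sbm_Pr_indep_block // /sbm_Pr [RHS]big_mkcond.
  by apply: eq_bigr => G _; case: ifP; rewrite ?mulr1 ?mulr0.
have EX2 : \sum_G sbm_mass P G * X G ^+ 2 <= mu ^+ 2 * S.
  under eq_bigr do rewrite expr2 /X big_distrlr /= mulr_sumr.
  under eq_bigr => G _ do under eq_bigr => U _ do rewrite mulr_sumr.
  rewrite exchange_big /=.
  have -> : mu ^+ 2 * S = \sum_(U in D) b ^+ 2 * (M * S).
    rewrite sumr_const cardD -mulr_natl -/M /mu; ring.
  apply: ler_sum => U UD; rewrite exchange_big /=.
  have UD' := UD; move: UD'; rewrite inE => /andP[sU /eqP cU].
  (* For fixed [U], the joint probability is [b ^+ 2] times a power of [expR (qmx P i i)] that
     depends only on the overlap. *)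
  have := @sum_overlap_le R _ (block i) s U (expR (qmx P i i)) (expR_ge0 _).
  rewrite card_block => /(_ s_n UD) ovl.
  apply: le_trans (ler_wpM2l (exprn_ge0 2 (ltW b0)) ovl).
  rewrite mulr_sumr; apply: ler_sum => W; rewrite inE => /andP[sW /eqP cW].
  rewrite expr2 /b -{1}cU -cW -sbm_Pr_indepI_block // /sbm_Pr.
  rewrite [leRHS]big_mkcond.
  apply: ler_sum => G _.
  by case: (indep_set G U); case: (indep_set G W); rewrite ?mulr1 ?mulr0.
apply: (@le_trans _ _
  (\sum_G sbm_mass P G * (2 * (X G / mu) - (X G / mu) ^+ 2))).
  under eq_bigr do rewrite mulrBr.
  rewrite sumrB.
  have -> : \sum_G sbm_mass P G * (2 * (X G / mu)) = 2.
    transitivity (2 / mu * \sum_G sbm_mass P G * X G).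
      by rewrite mulr_sumr; apply: eq_bigr => G _; ring.
    by rewrite EX divfK // gt_eqF.
  rewrite lerD2l lerN2.
  have -> : \sum_G sbm_mass P G * (X G / mu) ^+ 2 =
      (\sum_G sbm_mass P G * X G ^+ 2) / mu ^+ 2.
    by rewrite mulr_suml; apply: eq_bigr => G _; rewrite exprMn exprVn; ring.
  by rewrite ler_pdivrMr ?exprn_gt0 // mulrC.
rewrite /sbm_Pr [leRHS]big_mkcond; apply: ler_sum => G _.
have m0 := sbm_mass_ge0 P01 G.
case: ifP => [_ | /negbT/existsPn noU].
  rewrite -[leRHS]mulr1 ler_wpM2l //; set x := X G / mu.
  by have := sqr_ge0 (1 - x); nra.
rewrite /X big1 ?mul0r ?expr0n ?mulr0 ?subr0 ?mulr0 // => U.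
rewrite inE => /andP[sU cU]; have := noU U.
by rewrite sU cU /= => /negbTE ->.
Qed.

End Moments.

(** * Both tails of [alpha_h] for a single graph on [expR L] vertices *)

Section Concentration.
Variables (R : realType) (k : nat) (n : 'I_k -> nat) (P : 'M[R]_k).
Hypothesis P01 : forall i j, 0 <= P i j < 1.

Lemma norm1_sizes : norm1 (sizes R n) = #|vertex n|%:R.
Proof.
rewrite card_vertex natr_sum; apply: eq_bigr => i _.
by rewrite mxE ger0_norm.
Qed.

Lemma nmin_le i : (nmin n <= n i)%N.
Proof.
rewrite /nmin; move: (\sum_(j < k) n j)%N => x.
have : i \in index_enum 'I_k by rewrite mem_index_enum.
elim: (index_enum _) => // j js IH; rewrite big_cons inE.
by case/predU1P => [<- | /IH]; rewrite geq_min ?leqnn // => ->; rewrite orbT.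
Qed.

(** Positivity excludes [k = 0], where the maximum is its default [0]; for [k > 0] the default is
    harmless since the entries are nonnegative. *)
Lemma qstar_attained : 0 < qstar (qmx P) -> {i | qstar (qmx P) = qmx P i i}.
Proof.
move=> q0; have [i0 | no_i] := pickP (fun _ : 'I_k => true); last first.
  by move: q0; rewrite /qstar big_pred0 ?ltxx.
have [//|i|i _ qi] := @eq_bigmax _ _ _ 0 i0 predT (fun i => qmx P i i).
  by rewrite qmx_ge0.
by exists i.
Qed.

Variables (L sigma : R).
Hypothesis vertexE : #|vertex n|%:R = expR L.
Hypothesis L0 : 0 < L.
Hypothesis sigma01 : 0 <= sigma <= 1 / 2.

(** As [sigma <= 1 / 2], a set above the threshold weighs more than [L / 2], so the bound on [qmax]
    gives it at least [expR ((sigma - eps / 2) * L)] vertices. The exponents in [alpha_h_gt_le] then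
    add up to [- (eps / 2 * L)]. *)
Lemma alpha_h_upper (eps r : R) : 0 < eps ->
    qstar (qmx P) <= expR ((- sigma + eps / 2) * L) ->
    qmax (qmx P) <= 1 / 2 * qstar (qmx P) * L ->
    expR 1 * expR (- (eps / 2 * L)) <= r -> r <= 1 / 2 ->
  sbm_Pr (n := n) P (fun G => (1 - sigma + eps) * L < alpha_h P G) <= 2 * r.
Proof.
move=> eps0 qs qm Hr r1; case/andP: sigma01 => sg0 sg1.
pose s0 := expR ((sigma - eps / 2) * L).
apply: (@alpha_h_gt_le _ _ _ _ P01 _ s0) => //.
- by rewrite mulr_ge0 ?ltW //; lra.
- exact: expR_gt0.
- move=> U /lt_le_trans/(_ (hweight_le_qmax P01 U)) hU.
  have {}hU : L / 2 < #|U|%:R * (1 / 2 * expR ((- sigma + eps / 2) * L) * L).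
    apply: (@lt_le_trans _ _ (#|U|%:R * qmax (qmx P))).
      by apply: le_lt_trans hU; rewrite mulrC ler_pM2r //; lra.
    apply: ler_wpM2l => //; apply: le_trans qm _.
    by rewrite ler_pM2r // ler_pM2l.
  have {}hU : 1 < #|U|%:R * expR ((- sigma + eps / 2) * L).
    rewrite -(ltr_pM2r (x := L / 2)) ?divr_gt0 // mul1r.
    by apply: lt_le_trans hU _; lra.
  rewrite /s0 (_ : _ * L = - ((- sigma + eps / 2) * L)); last by ring.
  by rewrite expRN -[_^-1]mul1r ler_pdivrMr ?expR_gt0 // ltW.
apply: le_trans Hr; rewrite vertexE /s0 -expRN -!mulrA ler_pM2l ?expR_gt0 //.
by rewrite -!expRD ler_expR; lra.
Qed.

(** [kappa] measures the distance of [sigma] from [1 / 2], [delta] lowers the size of the sets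
    sought, and [eta] absorbs the [o(1)] errors. The second moment method runs in a block attaining
    [qstar], with [theta = kappa / 4]. *)
Lemma alpha_h_lower (kappa delta eta r : R) :
    0 < kappa <= 1 -> 2 * sigma <= 1 - kappa ->
    0 < delta <= 1 / 4 -> 0 < eta ->
    20 * eta <= kappa -> 6 * eta <= delta ->
    2 * L <= expR (eta * L) ->
    expR (- ((sigma + eta) * L)) <= qstar (qmx P) ->
    qmax (qmx P) <= eta * L ->
    expR ((1 - eta) * L) <= (nmin n)%:R ->
    expR (- (kappa / 2 * L)) <= r ->
    expR 1 / (kappa / 4) * expR (- (delta / 2 * L)) <= r -> r <= 1 / 2 ->
  1 - 2 * r <=
  sbm_Pr (n := n) P (fun G => (1 - sigma - delta - eta) * L <= alpha_h P G).
Proof.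
move=> /andP[ka0 ka1] sgk /andP[de0 de1] et0 etk etd L2 qs qm nm Hr1 Hr2 r1.
case/andP: sigma01 => sg0 sg1.
have q0 : 0 < qstar (qmx P) by apply: lt_le_trans qs; exact: expR_gt0.
have [i qi] := qstar_attained q0.
have qle : qmx P i i <= eta * L := le_trans (qmx_le_qmax _ _ _) qm.
rewrite qi in q0 qs; set q := qmx P i i in q0 qs qle.
pose A := (1 - sigma - delta) * L.
have A0 : L / 4 <= A by rewrite /A mulrC ler_pM2r //; lra.
have AL : A <= L by rewrite /A -[leRHS]mul1r ler_pM2r //; lra.
have etL : eta * L <= L / 20 by rewrite [leRHS]mulrC ler_pM2r //; lra.
(* A set of [s] vertices of the block weighs [(s - 1) / 2 * q], so this size aims at weight [A]. *)
pose s := Num.trunc (2 * A / q).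
have /andP[sA As] : s%:R <= 2 * A / q < s.+1%:R.
  by apply: truncn_itv; rewrite divr_ge0 ?ltW //; lra.
have sq : q * s%:R / 2 <= A.
  by move: sA; rewrite ler_pdivlMr // => ?; lra.
have s0 : (0 < s)%N.
  have : 1 <= 2 * A / q by rewrite ler_pdivlMr //; lra.
  by rewrite -ltnS -(ltr_nat R) => /le_lt_trans; apply.
(* The second [eta] in the exponent pays for [2 * A <= 2 * L <= expR (eta * L)]. *)
have sle : s%:R <= expR ((sigma + 2 * eta) * L).
  apply: le_trans sA _; rewrite ler_pdivrMr //.
  apply: (@le_trans _ _
    (expR ((sigma + 2 * eta) * L) * expR (- ((sigma + eta) * L)))).
    rewrite -expRD (_ : _ - _ = eta * L); last by ring.
    by lra.
  by rewrite ler_pM2l ?expR_gt0.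
have nle : expR ((1 - eta) * L) <= (n i)%:R.
  by apply: le_trans nm _; rewrite ler_nat nmin_le.
have n0 : 0 < ((n i)%:R : R) by apply: lt_le_trans nle; exact: expR_gt0.
have sn : (s <= n i)%N.
  rewrite -(ler_nat R); apply: le_trans sle _; apply: le_trans nle.
  by rewrite ler_expR ler_pM2r //; lra.
have nV : (n i)%:R^-1 <= expR (- ((1 - eta) * L)).
  by rewrite expRN lef_pV2 ?posrE ?expR_gt0.
have snV : s%:R / (n i)%:R <= expR ((sigma + 2 * eta) * L - (1 - eta) * L).
  by rewrite expRD; apply: ler_pM; rewrite ?invr_ge0.
(* In units of [L] the exponent is at most [2 * sigma - 1 + 5 * eta + kappa / 4 <= - kappa / 2]. *)
have small : s%:R * s%:R / (n i)%:R * expR (kappa / 4 * (q * s%:R / 2)) <= r.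
  apply: le_trans Hr1.
  apply: (@le_trans _ _ (expR ((sigma + 2 * eta) * L) *
      expR ((sigma + 2 * eta) * L - (1 - eta) * L) * expR (kappa / 4 * L))).
    apply: ler_pM; rewrite ?expR_ge0 ?mulr_ge0 ?invr_ge0 //.
      by rewrite -mulrA; apply: ler_pM; rewrite ?mulr_ge0 ?invr_ge0.
    by rewrite ler_expR; nra.
  by rewrite -!expRD ler_expR; nra.
(* Here [sigma] cancels, leaving [3 * eta - delta <= - delta / 2]. *)
have big : expR 1 / (kappa / 4) * (s%:R / (n i)%:R) * expR (q * s%:R / 2) <= r.
  apply: le_trans Hr2; rewrite -mulrA; apply: ler_wpM2l.
    by rewrite divr_ge0 ?expR_ge0 // divr_ge0 // ltW.
  apply: (@le_trans _ _
    (expR ((sigma + 2 * eta) * L - (1 - eta) * L) * expR A)).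
    by apply: ler_pM; rewrite ?expR_ge0 ?mulr_ge0 ?invr_ge0 // ler_expR.
  by rewrite -expRD ler_expR /A; nra.
have ka4 : 0 < kappa / 4 by lra.
have n0' : (0 < n i)%N := leq_trans s0 sn.
have ovl := overlap_sum_le ka4 (ltW q0) s0 n0' r1 small big.
apply: (@le_trans _ _ (2 - (1 + 2 * r))); first by lra.
apply: le_trans (lerB (lexx 2) ovl) _.
apply: le_trans (block_second_moment P01 _) _; first by rewrite s0.
apply: sbm_Pr_sub => // G /existsP[U /and3P[sU /eqP cU iU]].
have U0 : U != finset.set0 by rewrite -card_gt0 cU.
apply: le_trans (_ : hweight P U <= _); last first.
  by apply: (le_bigmax_cond 0 (hweight P)); rewrite U0.
rewrite (hweight_block P01 sU U0) cU -/q.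
(* From [s + 1 > 2 * A / q] the weight exceeds [A - q], and [q <= eta * L]: the last [eta] pays for
   the rounding and for the [- 1] in the weight. *)
move: As; rewrite -[s.+1%:R]natr1 ltr_pdivrMr // => As.
have -> : (1 - sigma - delta - eta) * L = A - eta * L by rewrite /A; ring.
by lra.
Qed.

End Concentration.

Local Open Scope classical_set_scope.
Local Open Scope ring_scope.

(** * Exponential estimates as [L] tends to infinity *)

Section LargeScale.
Variables (R : realType) (L : nat -> R).
Hypothesis L_oo : L m @[m --> \oo] --> +oo.

(** For [C > 0], [1 + x <= expR x] makes [L m >= C / (a * r)] sufficient. *)
Lemma near_expRN_le (C a r : R) : 0 < a -> 0 < r ->
  \forall m \near \oo, C * expR (- (a * L m)) <= r.
Proof.
move=> a0 r0.
have [C0 | C0] := leP C 0.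
  apply: nearW => m; apply: le_trans (ltW r0).
  by rewrite mulr_le0_ge0 ?expR_ge0.
have /cvgryPge/(_ (C / (a * r))) := L_oo; apply: filterS => m.
rewrite ler_pdivrMr ?mulr_gt0 // => Lm.
rewrite expRN ler_pdivrMr ?expR_gt0 //.
by have := expR_ge1Dx (a * L m); nra.
Qed.

(** The quadratic term [(a * L m) ^+ 2 / 2] of the exponential is at least [2 * L m] once
    [L m >= 4 / a ^+ 2]. *)
Lemma near_le_expR (a : R) : 0 < a ->
  \forall m \near \oo, 2 * L m <= expR (a * L m).
Proof.
move=> a0; have /cvgryPge/(_ (4 / a ^+ 2)) := L_oo; apply: filterS => m.
rewrite ler_pdivrMr ?exprn_gt0 // => Lm.
have Lm0 : 0 <= L m.
  by rewrite -(pmulr_lge0 _ (exprn_gt0 2 a0)); apply: le_trans Lm.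
apply: le_trans (expR_ge1Dxn 1 _); last by rewrite mulr_ge0 // ltW.
rewrite exprMn (_ : 2`!%:R = 2 :> R) //; nra.
Qed.

End LargeScale.

(** * Choice of parameters and passage to the limit *)

Unset Implicit Arguments.

Theorem theorem4p3 (R : realType) (k : nat -> nat)
    (n : forall m : nat, 'I_(k m) -> nat) (P : forall m : nat, 'M[R]_(k m))
    (sigma : nat -> R) (sigma0 : R)
    (N := fun m => norm1 (sizes R (n m)))
    (Q := fun m => qmx (P m))
    (hPsym : forall (m : nat) (i j : 'I_(k m)), P m i j = P m j i)
    (hP : forall (m : nat) (i j : 'I_(k m)), 0 <= P m i j < 1)
    (hsigma0 : 0 < sigma0 < 1 / 2)
    (hsigma : forall m : nat, 0 <= sigma m <= sigma0)
    (hN : N m @[m --> \oo] --> +oo)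
    (hk : eq_pow_o1 (fun m => (k m)%:R) N (fun=> 0))
    (hqstar : eq_pow_o1 (fun m => qstar (Q m)) N (fun m => - sigma m))
    (hqhat : eq_pow_o1 (fun m => qhat (sizes R (n m)) (Q m)) N
               (fun m => - sigma m))
    (hqmax : (fun m => (1 + 1 / qstar (Q m)) * qmax (Q m)) =o_\oo
               (fun m => ln (N m)))
    (hnmin : eq_pow_o1 (fun m => (nmin (n m))%:R) N (fun=> 1))
    (hnminw : (fun m => wfun (sizes R (n m)) (Q m) / ln (N m)) =o_\oo
                (fun m => (nmin (n m))%:R : R)) :
  forall eps : R, 0 < eps ->
    sbm_Pr (n := n m) (P m) (fun G =>
      `|alpha_h (P m) G - (1 - sigma m) * ln (N m)| <= eps * ln (N m))
    @[m --> \oo] --> (1 : R).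
Proof.
move=> eps eps0.
pose L m := ln (N m).
have L_oo : L m @[m --> \oo] --> +oo.
  apply/cvgryPge => K; have /cvgryPge/(_ (expR K)) := hN.
  apply: filterS => m NK.
  rewrite -[K]expRK ler_ln ?posrE ?expR_gt0 //.
  exact: lt_le_trans (expR_gt0 K) NK.
(* [sigma m <= sigma0] makes the gap [kappa] uniform in [m]; [delta] and [eta] are chosen so that
   [delta + eta <= eps]. *)
pose kappa := 1 - 2 * sigma0.
pose delta := Num.min (eps / 2) (1 / 4).
pose eta := Num.min (kappa / 20) (delta / 6).
have ka0 : 0 < kappa <= 1 by rewrite /kappa; lra.
have de0 : 0 < delta <= 1 / 4 by rewrite lt_min ge_min lexx orbT; lra.
have de_eps : delta <= eps / 2 by rewrite ge_min lexx.
have et0 : 0 < eta by rewrite lt_min; lra.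
have et_ka : eta <= kappa / 20 by rewrite ge_min lexx.
have et_de : eta <= delta / 6 by rewrite ge_min lexx orbT.
case: hqstar => e1 e1_0 qsE; case: hnmin => e2 e2_0 nmE.
apply/cvgrPdist_le => rho rho0.
(* Each of the two tails will cost at most [2 * r <= rho / 2]. *)
pose r := Num.min (rho / 4) (1 / 2).
have r0 : 0 < r by rewrite lt_min; lra.
have r1 : r <= 1 / 2 by rewrite ge_min lexx orbT.
have r_rho : r <= rho / 4 by rewrite ge_min lexx.
near=> m.
have Lm0 : 0 < L m.
  apply: (@lt_le_trans _ _ 1) => //; near: m.
  by have /cvgryPge := L_oo; apply.
(* [ln] is [0] on nonpositive reals, so [0 < L m] forces [0 < N m]. *)
have NE : N m = expR (L m).
  rewrite lnK // posrE ltNge; apply/negP => /ln0 lnN0.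
  by move: Lm0; rewrite /L lnN0 ltxx.
have N0 : 0 < N m by rewrite NE expR_gt0.
have powE x : N m `^ x = expR (x * L m) by rewrite /powR gt_eqF.
have vE : #|vertex (n m)|%:R = expR (L m) by rewrite -norm1_sizes -NE.
have e1m : `|e1 m| <= eta by near: m; apply: cvgr0_norm_le.
have e2m : `|e2 m| <= eta by near: m; apply: cvgr0_norm_le.
have qs : qstar (Q m) = N m `^ (- sigma m + e1 m) by near: m.
have nm : (nmin (n m))%:R = N m `^ (1 + e2 m) by near: m.
have qm : `|(1 + 1 / qstar (Q m)) * qmax (Q m)| <= eta * `|ln (N m)|.
  by near: m; have /eqoP := hqmax; apply.
have q0 : 0 < qstar (Q m) by rewrite qs powR_gt0.
have qm0 : 0 <= qmax (Q m) := qmax_ge0 _.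
have /andP[e1l e1u] : - eta <= e1 m <= eta by rewrite -ler_norml.
have /andP[e2l e2u] : - eta <= e2 m <= eta by rewrite -ler_norml.
(* Both summands are nonnegative: bounding [qmax] serves the lower tail, bounding [qmax / qstar] the
   upper one. *)
have {}qm : qmax (Q m) + qmax (Q m) / qstar (Q m) <= eta * L m.
  move: qm; rewrite -/(L m) (gtr0_norm Lm0) ger0_norm; last first.
    by rewrite mulr_ge0 // addr_ge0 // divr_ge0 // ltW.
  by rewrite mulrDl mul1r [_ / _ * _]mulrC mulrA mulr1.
have qd0 : 0 <= qmax (Q m) / qstar (Q m) by rewrite divr_ge0 // ltW.
have sg := hsigma m.
have sg01 : 0 <= sigma m <= 1 / 2 by lra.
have up : sbm_Pr (n := n m) (P m)
    (fun G => (1 - sigma m + eps) * L m < alpha_h (P m) G) <= 2 * r.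
  apply: alpha_h_upper => //.
  - by rewrite -/(Q m) qs powE ler_expR ler_pM2r //; lra.
  - rewrite -/(Q m) -mulrA mulrCA mulrC -ler_pdivrMr //.
    have : eta * L m <= 1 / 2 * L m by rewrite ler_pM2r //; lra.
    by lra.
  - by near: m; apply: near_expRN_le => //; lra.
have low : 1 - 2 * r <= sbm_Pr (n := n m) (P m)
    (fun G => (1 - sigma m - delta - eta) * L m <= alpha_h (P m) G).
  apply: (@alpha_h_lower _ _ _ _ (hP m) _ _ Lm0 sg01 kappa) => //.
  - by rewrite /kappa; lra.
  - by lra.
  - by lra.
  - by near: m; exact: near_le_expR.
  - by rewrite -/(Q m) qs powE ler_expR -mulNr ler_pM2r //; lra.
  - by rewrite -/(Q m); lra.
  - by rewrite nm powE ler_expR ler_pM2r //; lra.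
  - rewrite -[leLHS]mul1r; near: m; apply: near_expRN_le => //; lra.
  - by near: m; apply: near_expRN_le => //; lra.
rewrite ger0_norm ?subr_ge0 ?sbm_Pr_le1 // -sbm_PrC //.
pose hi (G : sgraph (vertex (n m))) :=
  (1 - sigma m + eps) * L m < alpha_h (P m) G.
pose lo (G : sgraph (vertex (n m))) :=
  (1 - sigma m - delta - eta) * L m <= alpha_h (P m) G.
(* A deviation beyond [eps * L m] implies [hi] or the failure of [lo], because
   [delta + eta <= eps]. *)
have le_hilo : sbm_Pr (n := n m) (P m) (predC (fun G =>
    `|alpha_h (P m) G - (1 - sigma m) * ln (N m)| <= eps * ln (N m))) <=
    sbm_Pr (P m) (fun G => hi G || predC lo G).
  apply: sbm_Pr_sub => // G /=; apply: contraR; rewrite negb_or negbK -leNgt.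
  rewrite /lo -/(L m) ler_norml => /andP[hiG loG].
  have : (delta + eta) * L m <= eps * L m by rewrite ler_pM2r //; lra.
  by move=> ?; apply/andP; split; lra.
apply: le_trans le_hilo _; apply: le_trans (sbm_PrU (hP m) _ _) _.
by rewrite sbm_PrC //; move: up low; rewrite -/hi -/lo; lra.
Unshelve. all: by end_near.
Qed.
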